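(* Let $n,p,r,k,\ell\ge 1$ be integers, let $\gamma>0$, let $X\in\mathbb{R}^{n\times p}$ have rows $x_1,\dots,x_n\in\mathbb{R}^p$, and let $Y=(y_1,\dots,y_n)\in\mathbb{R}^n$. Let $m_1,\dots,m_f$, $A(j)$, $\mathcal{P}_{k,\ell}$ and $\|g\|$ be as defined in the context. For $j\in[f]$ let $K_j := m_j(X)\, m_j(X)^\top\in\mathbb{R}^{n\times n}$, which is positive semidefinite. Then the hierarchical $(k,\ell)$-sparse regression problem $$\min_{g\in\mathcal{P}_{k,\ell}}\ \frac12\sum_{t\in[n]}\bigl(y_t-g(x_t)\bigr)^2+\frac{1}{2\gamma}\|g\|^2 \qquad (\mathrm{P})$$ can be reformulated as the pure binary optimization problem $$\begin{array}{rl}\min & \dfrac12\, Y^\top\Bigl(\mathbb{I}_n+\gamma\sum_{j\in[f]} s_jK_j\Bigr)^{-1}Y\\[0.8em] \text{s.t.} & s\in\{0,1\}^f,\ \sum_{j\in[f]}s_j\le \ell,\quad h\in\{0,1\}^p,\ \sum_{i\in[p]}h_i\le k,\\[0.4em] & s_j\le h_i\quad\forall i\in A(j),\ \forall j\in[f].\end{array}\qquad (\mathrm{Q})$$ That is, $(\mathrm{P})$ and $(\mathrm{Q})$ have the same optimal value, and a feasible pair $(s,h)$ of $(\mathrm{Q})$ is optimal for $(\mathrm{Q})$ if and only if there is an optimal solution $g=\sum_{j\in[f]}w_jm_j$ of $(\mathrm{P})$ with $w_j=0$ for every $j$ with $s_j=0$.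
   Context: Notation: $[n]=\{1,\dots,n\}$ and $\mathbb{I}_n$ is the $n\times n$ identity matrix. Monomials: let $f=\binom{p+r}{r}$ be the number of monomials of total degree at most $r$ in the $p$ inputs (variables) $x_1,\dots,x_p$, indexed by $j\in[f]$. The scaled monomial $m_j:\mathbb{R}^p\to\mathbb{R}$ with exponent vector $a=(a_1,\dots,a_p)\in\mathbb{Z}_{\ge0}^p$, $a_1+\dots+a_p\le r$, is $$m_j(x)=\sqrt{\frac{r!}{a_0!\,a_1!\cdots a_p!}}\;\prod_{i=1}^p x_i^{a_i},\qquad a_0:=r-\sum_{i=1}^p a_i .$$ For $X$ with rows $x_1,\dots,x_n$, write $m_j(X)=(m_j(x_1),\dots,m_j(x_n))^\top\in\mathbb{R}^n$. The ancestors $A(j)$ of $j$ are the inputs $i\in[p]$ on which $m_j$ depends, i.e. those with $a_i\ge1$ (empty for the constant monomial). Every polynomial $g$ of degree at most $r$ in $p$ variables is written uniquely as $g=\sum_{j\in[f]}w_jm_j$, and $\|g\|^2:=\sum_{j\in[f]}w_j^2$ is the sum of squares of its coefficients in this scaled basis. $\mathcal{P}_{k,\ell}$ is the set of $(k,\ell)$-sparse polynomials of total degree at most $r$: those $g=\sum_j w_jm_j$ with at most $\ell$ nonzero coefficients $w_j$ and such that the monomials $m_j$ with $w_j\neq0$ together depend on at most $k$ of the $p$ inputs. *)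

(* Defs.v *)
From HB Require Import structures.
From mathcomp Require Import all_boot all_order all_algebra.
From mathcomp Require Import reals.
From mathcomp Require Import mpoly.

Set Implicit Arguments.
Unset Strict Implicit.
Unset Printing Implicit Defensive.

Import Order.TTheory GRing.Theory Num.Theory.
Local Open Scope ring_scope.

(* The index set [f] of the monomials of degree at most r is the finite type
   'X_{1..p < r.+1} of exponent vectors of degree < r.+1; its cardinality is
   f = 'C(p + r, r), see card_monom. *)

Section Optimization.
Variables (R : realType) (T : Type) (feas : T -> Prop) (obj : T -> R).

Definition is_optimal (x : T) : Prop :=
  feas x /\ forall y, feas y -> obj x <= obj y.

Definition is_optval (v : R) : Prop := exists2 x, is_optimal x & obj x = v.

End Optimization.

Definition is_psd (R : realType) (n : nat) (A : 'M[R]_n) : Prop :=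
  A^T = A /\ forall u : 'cV[R]_n, 0 <= (u^T *m A *m u) 0 0.

Section Monomials.
Variables (R : realType) (p r : nat).
Implicit Types (j : 'X_{1..p < r.+1}) (g : {mpoly R[p]}).

Definition mscale j : R :=
  Num.sqrt (r`!%:R / ((r - mdeg j)`! * \prod_(i < p) (j i)`!)%:R).

Definition smonom j : {mpoly R[p]} := mscale j *: 'X_[j].

Definition ancestors j : {set 'I_p} := [set i | (1 <= j i)%N].

(* The coefficient w_j of g in the scaled basis; see smonom_decomp and
   scoef_unique. *)
Definition scoef g j : R := g@_j / mscale j.

Definition sqnorm g : R := \sum_j scoef g j ^+ 2.

Definition ssupp g : {set 'X_{1..p < r.+1}} := [set j | scoef g j != 0].

(* msize is the total degree plus one (and 0 for the zero polynomial). *)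
Definition sparse_poly (k l : nat) g : Prop :=
  [/\ (msize g <= r.+1)%N,
      (#|ssupp g| <= l)%N
    & (#|\bigcup_(j in ssupp g) ancestors j| <= k)%N].

End Monomials.

Section Regression.
Variables (R : realType) (n p r : nat) (gamma : R).
Variables (X : 'M[R]_(n, p)) (Y : 'cV[R]_n).

Definition regr_obj (g : {mpoly R[p]}) : R :=
  2^-1 * (\sum_(t < n) (Y t 0 - g.@[fun i => X t i]) ^+ 2)
  + (2 * gamma)^-1 * sqnorm r g.

Definition smonom_vec (j : 'X_{1..p < r.+1}) : 'cV[R]_n :=
  \col_(t < n) (smonom R j).@[fun i => X t i].

Definition kernel_mx (j : 'X_{1..p < r.+1}) : 'M[R]_n :=
  smonom_vec j *m (smonom_vec j)^T.

Definition binvars : Type :=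
  ({ffun 'X_{1..p < r.+1} -> bool} * {ffun 'I_p -> bool})%type.

Definition bin_feasible (k l : nat) (sh : binvars) : Prop :=
  [/\ (\sum_j sh.1 j <= l)%N,
      (\sum_i sh.2 i <= k)%N
    & forall j i, i \in ancestors j -> (sh.1 j <= sh.2 i)%N].

Definition ridge_mx (s : {ffun 'X_{1..p < r.+1} -> bool}) : 'M[R]_n :=
  1%:M + gamma *: \sum_j (s j)%:R *: kernel_mx j.

(* invmx is a genuine inverse here, see ridge_mx_unit. *)
Definition bin_obj (sh : binvars) : R :=
  2^-1 * (Y^T *m invmx (ridge_mx sh.1) *m Y) 0 0.

End Regression.

Section Facts.
Variables (R : realType) (p r : nat).
Implicit Types (j : 'X_{1..p < r.+1}) (g : {mpoly R[p]}).

Lemma card_monom : #|{: 'X_{1..p < r.+1}}| = 'C(p + r, r).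
Proof.
have -> : 'C(p + r, r) = 'C(p + r, p) by rewrite -(bin_sub (leq_addl p r)) addnK.
rewrite -card_partial_ord_partitions.
have lej (j : 'X_{1..p < r.+1}) i : (j i < r.+1)%N.
  apply: leq_ltn_trans (bmdeg j).
  by rewrite mdegE (bigD1 i) //= leq_addr.
pose F j : p.-tuple 'I_r.+1 := [tuple Ordinal (lej j i) | i < p].
have Finj : injective F.
  move=> j1 j2 E; apply/val_inj/mnmP=> i /=.
  by have /(congr1 (fun t => val (tnth t i))) := E; rewrite !tnth_mktuple.
rewrite -[LHS](card_image Finj); apply: eq_card => t; rewrite !inE.
apply/imageP/idP=> [[j _ ->]|tle].
  rewrite big_tuple -ltnS; under eq_bigr do rewrite tnth_mktuple /=.
  by rewrite -mdegE; apply: bmdeg.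
have lt : (mdeg [multinom (tnth t i : nat) | i < p] < r.+1)%N.
  by rewrite mdegE ltnS; under eq_bigr do rewrite mnmE; rewrite -(big_tuple _ _ _ xpredT (fun x : 'I_r.+1 => x : nat)).
exists (BMultinom lt) => //; apply/eq_from_tnth=> i.
by apply/val_inj; rewrite tnth_mktuple /= mnmE.
Qed.

Lemma mscale_gt0 j : 0 < mscale R j.
Proof.
rewrite sqrtr_gt0 divr_gt0 // ltr0n ?fact_gt0 // muln_gt0 fact_gt0 /=.
by apply: prodn_gt0 => i; apply: fact_gt0.
Qed.

Lemma scoef_unique (w : 'X_{1..p < r.+1} -> R) j :
  scoef (\sum_j' w j' *: smonom R j') j = w j.
Proof.
rewrite /scoef raddf_sum /= (bigD1 j) //= big1 ?addr0 => [|j' /negPf ne].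
  by rewrite !mcoeffZ mcoeffX eqxx mulr1 mulfK // gt_eqF // mscale_gt0.
by rewrite !mcoeffZ mcoeffX -bmeqP ne !mulr0.
Qed.

Lemma smonom_decomp g : (msize g <= r.+1)%N ->
  g = \sum_(j : 'X_{1..p < r.+1}) scoef g j *: smonom R j.
Proof.
move=> sz; rewrite {1}(mpolywE sz); apply: eq_bigr => j _.
by rewrite /smonom scalerA divfK // gt_eqF // mscale_gt0.
Qed.

Lemma ridge_mx_unit n (gamma : R) (X : 'M[R]_(n, p))
  (s : {ffun 'X_{1..p < r.+1} -> bool}) :
  0 < gamma -> ridge_mx gamma X s \in unitmx.
Proof.
move=> g0; rewrite -row_free_unit -kermx_eq0; apply/eqP/row_matrixP => i.
rewrite row0; set u := row i _.
have uA : u *m ridge_mx gamma X s = 0.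
  by apply/sub_kermxP; rewrite row_sub.
have sq m (v : 'rV[R]_m) : (v *m v^T) 0 0 = \sum_k v 0 k ^+ 2.
  by rewrite mxE; apply: eq_bigr => k _; rewrite mxE expr2.
have sq0 m (v : 'rV[R]_m) : 0 <= (v *m v^T) 0 0.
  by rewrite sq; apply: sumr_ge0 => k _; rewrite sqr_ge0.
have := congr1 (fun M => (M *m u^T) 0 0) uA.
rewrite /= mul0mx mulmxDr mulmxDl mulmx1 -scalemxAr -scalemxAl.
rewrite mulmx_sumr mulmx_suml !mxE [X in _ + gamma * X]summxE => E0.
have rest : 0 <= gamma * (\sum_j
    (u *m ((s j)%:R *: kernel_mx X j) *m u^T) 0 0).
  rewrite mulr_ge0 ?(ltW g0) //; apply: sumr_ge0 => j _.
  rewrite -scalemxAr -scalemxAl mxE mulr_ge0 ?ler0n // /kernel_mx.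
  set c := smonom_vec X j.
  have -> : u *m (c *m c^T) *m u^T = (u *m c) *m (u *m c)^T.
    by rewrite trmx_mul !mulmxA.
  exact: sq0.
have /eqP : \sum_k u 0 k ^+ 2 = 0.
  apply/eqP; rewrite eq_le; apply/andP; split; last first.
    by apply: sumr_ge0 => k _; rewrite sqr_ge0.
  rewrite -sq mxE -(lerD2r (gamma * (\sum_j
    (u *m ((s j)%:R *: kernel_mx X j) *m u^T) 0 0))) add0r.
  by rewrite E0.
rewrite psumr_eq0 => [/allP u0|k _]; last exact: sqr_ge0.
apply/rowP=> k; have := u0 k (mem_index_enum k).
by rewrite sqrf_eq0 => /eqP ->; rewrite mxE.
Qed.

End Facts.

(* Main.v *)
Require Import Defs.
From HB Require Import structures.
From mathcomp Require Import all_boot all_order all_algebra.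
From mathcomp Require Import reals.
From mathcomp Require Import mpoly.
From mathcomp Require Import ring.

Set Implicit Arguments.
Unset Strict Implicit.
Unset Printing Implicit Defensive.

Import Order.TTheory GRing.Theory Num.Theory.
Local Open Scope ring_scope.

(** Once the set [s] of admissible monomials is fixed, (P) is a ridge
    regression, whose optimal value is the objective of (Q) at [s].  Indeed put
    [alpha := (1 + gamma * \sum_j s_j K_j)^-1 Y] and
    [c_j := <m_j(X), alpha>].  Completing both squares around the residual
    [alpha] and the weights [gamma * s_j * c_j] gives, for every weight vector
    [w] supported on [s] (lemma [ridge_complete_squares]),
    [[
      1/2 |Y - \sum_j w_j m_j(X)|^2 + 1/(2 gamma) |w|^2
      = 1/2 <Y, alpha> + 1/2 |Y - \sum_j w_j m_j(X) - alpha|^2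
        + 1/(2 gamma) \sum_j (w_j - gamma s_j c_j)^2.
    ]]
    The last two terms are nonnegative, and both vanish for
    [w_j := gamma * s_j * c_j], since then the residual is [alpha] by the very
    definition of [alpha].  Hence the (Q)-objective at [s] bounds from below
    the (P)-objective of each polynomial supported on [s] ([bin_obj_le]), and
    equals that of the polynomial [ridge_poly] ([regr_obj_ridge_poly]).

    Both feasible sets match: a polynomial supported on a feasible [(s, h)] is
    sparse ([sparse_poly_supported]), and a sparse polynomial is supported on
    the feasible pair made of its support and of the inputs occurring in it
    ([bin_feasible_of_poly]).  The theorem follows by comparing values, since
    (Q) has an optimal solution, its feasible set being finite and nonempty. *)

(** * Ridge regression on a fixed family of features *)

(** Here [phi j t] is the value of feature [j] at data point [t].  Expanding
    the squares, the identity reduces to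
    [<Y, alpha> = |alpha|^2 + gamma \sum_j s_j c_j^2], which is the normal
    equation [normal_eq] paired with [alpha]. *)
Lemma ridge_complete_squares (R : realFieldType) (n : nat) (J : finType)
    (gamma : R) (phi : J -> 'I_n -> R) (y alpha : 'I_n -> R) (s : J -> bool)
    (w : J -> R) (c := fun j => \sum_t phi j t * alpha t) :
  gamma != 0 ->
  forall (normal_eq : forall t,
    y t = alpha t + gamma * \sum_j (s j)%:R * c j * phi j t)
    (supp_w : forall j, s j = false -> w j = 0),
  2^-1 * (\sum_t (y t - \sum_j w j * phi j t) ^+ 2)
    + (2 * gamma)^-1 * \sum_j w j ^+ 2
  = 2^-1 * (\sum_t y t * alpha t)
    + 2^-1 * (\sum_t (y t - \sum_j w j * phi j t - alpha t) ^+ 2)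
    + (2 * gamma)^-1 * \sum_j (w j - gamma * (s j)%:R * c j) ^+ 2.
Proof.
move=> gamma0 normal_eq supp_w.
have pairE (v : J -> R) :
    \sum_t (\sum_j v j * phi j t) * alpha t = \sum_j v j * c j.
  under eq_bigr do rewrite mulr_suml.
  rewrite exchange_big; apply: eq_bigr => j _; rewrite mulr_sumr.
  by apply: eq_bigr => t _; rewrite mulrA.
have y_alpha : \sum_t y t * alpha t
    = \sum_t alpha t ^+ 2 + gamma * \sum_j (s j)%:R * c j ^+ 2.
  rewrite (eq_bigr (fun t => alpha t ^+ 2 +
    gamma * ((\sum_j ((s j)%:R * c j) * phi j t) * alpha t))); last first.
    by move=> t _; rewrite {1}normal_eq; ring.
  rewrite big_split -mulr_sumr pairE /=; congr (_ + _ * _).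
  by apply: eq_bigr => j _; ring.
have residual : \sum_t (y t - \sum_j w j * phi j t - alpha t) ^+ 2
    = \sum_t (y t - \sum_j w j * phi j t) ^+ 2
      - 2 * (\sum_t y t * alpha t) + 2 * (\sum_j w j * c j)
      + \sum_t alpha t ^+ 2.
  rewrite -pairE !mulr_sumr -sumrB -!big_split /=.
  by apply: eq_bigr => t _; ring.
have weights : \sum_j (w j - gamma * (s j)%:R * c j) ^+ 2
    = \sum_j w j ^+ 2 - 2 * gamma * (\sum_j w j * c j)
      + gamma ^+ 2 * \sum_j (s j)%:R * c j ^+ 2.
  rewrite !mulr_sumr -sumrB -big_split /=; apply: eq_bigr => j _.
  by case sj: (s j) => /=; [ring | rewrite supp_w //; ring].
by rewrite residual weights y_alpha; field.
Qed.

Section Regression.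
Variables (R : realType) (n p r : nat) (gamma : R).
Variables (X : 'M[R]_(n, p)) (Y : 'cV[R]_n).
Hypothesis gamma_gt0 : 0 < gamma.
Implicit Types (j : 'X_{1..p < r.+1}) (s : {ffun 'X_{1..p < r.+1} -> bool}).
Implicit Types (g : {mpoly R[p]}) (sh : binvars p r).

Lemma kernel_mx_psd j : is_psd (kernel_mx X j).
Proof.
split=> [|u]; first by rewrite /kernel_mx trmx_mul trmxK.
rewrite /kernel_mx; set c := smonom_vec X j.
have -> : u^T *m (c *m c^T) *m u = (c^T *m u)^T *m (c^T *m u).
  by rewrite trmx_mul trmxK !mulmxA.
by rewrite mxE; apply: sumr_ge0 => i _; rewrite mxE -expr2 sqr_ge0.
Qed.

(** * From polynomials to weights *)

Definition supported_on s g : Prop :=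
  forall j, s j = false -> scoef g j = 0.

Lemma regr_objE g : (msize g <= r.+1)%N ->
  regr_obj r gamma X Y g =
  2^-1 * (\sum_t (Y t 0 - \sum_j scoef g j * smonom_vec (r := r) X j t 0) ^+ 2)
    + (2 * gamma)^-1 * \sum_(j : 'X_{1..p < r.+1}) scoef g j ^+ 2.
Proof.
move=> g_deg; rewrite /regr_obj /sqnorm; congr (_ * _ + _).
apply: eq_bigr => t _; congr ((_ - _) ^+ 2).
rewrite {1}(smonom_decomp g_deg) raddf_sum.
by apply: eq_bigr => j _; rewrite /= mevalZ mxE.
Qed.

(** The residual [Y - \sum_j w_j m_j(X)] of the best weights supported on
    [s]. *)
Definition dual_vec s : 'cV[R]_n :=
  invmx (ridge_mx gamma X s) *m Y.

Definition dual_coef s j : R := \sum_t smonom_vec X j t 0 * dual_vec s t 0.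

Definition ridge_poly s : {mpoly R[p]} :=
  \sum_j (gamma * (s j)%:R * dual_coef s j) *: smonom R j.

Lemma dual_vec_normal_eq s t :
  Y t 0 = dual_vec s t 0
          + gamma * \sum_j (s j)%:R * dual_coef s j * smonom_vec X j t 0.
Proof.
have -> : Y t 0 = (ridge_mx gamma X s *m dual_vec s) t 0.
  by rewrite /dual_vec mulKVmx // ridge_mx_unit.
rewrite /ridge_mx mulmxDl mul1mx -scalemxAl mulmx_suml mxE; congr (_ + _).
rewrite mxE summxE; congr (_ * _); apply: eq_bigr => j _.
rewrite -scalemxAl mxE /kernel_mx -mulmxA mxE big_ord1 -mulrA; congr (_ * _).
rewrite mulrC; congr (_ * _); rewrite mxE.
by apply: eq_bigr => i _; rewrite mxE.
Qed.

Lemma bin_objE sh :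
  bin_obj gamma X Y sh = 2^-1 * \sum_t Y t 0 * dual_vec sh.1 t 0.
Proof.
rewrite /bin_obj -mulmxA mxE; congr (_ * _).
by apply: eq_bigr => t _; rewrite mxE.
Qed.

Lemma regr_obj_complete_squares sh g :
    (msize g <= r.+1)%N -> supported_on sh.1 g ->
  regr_obj r gamma X Y g =
  bin_obj gamma X Y sh
    + 2^-1 * (\sum_t (Y t 0 - \sum_j scoef g j * smonom_vec (r := r) X j t 0
                      - dual_vec sh.1 t 0) ^+ 2)
    + (2 * gamma)^-1
      * \sum_j (scoef g j - gamma * (sh.1 j)%:R * dual_coef sh.1 j) ^+ 2.
Proof.
move=> g_deg g_supp; rewrite regr_objE // bin_objE.
apply: (@ridge_complete_squares _ _ _ _ (fun j t => smonom_vec X j t 0)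
  (fun t => Y t 0) (fun t => dual_vec sh.1 t 0)) => //.
- by rewrite gt_eqF.
- exact: dual_vec_normal_eq.
Qed.

Lemma bin_obj_le sh g : (msize g <= r.+1)%N -> supported_on sh.1 g ->
  bin_obj gamma X Y sh <= regr_obj r gamma X Y g.
Proof.
move=> g_deg g_supp; rewrite (regr_obj_complete_squares (sh := sh)) // -addrA lerDl.
have sumsq_ge0 (T : finType) (F : T -> R) : 0 <= \sum_x F x ^+ 2.
  by apply: sumr_ge0 => x _; apply: sqr_ge0.
by apply: addr_ge0; apply: mulr_ge0; rewrite // invr_ge0 ?pmulr_rge0 ?ltW.
Qed.

Lemma msize_sum_smonom (w : 'X_{1..p < r.+1} -> R) :
  (msize (\sum_j w j *: smonom R j) <= r.+1)%N.
Proof.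
apply: leq_trans (msize_sum _ _ _) _; apply/bigmax_leqP => j _.
apply: leq_trans (msizeZ_le _ _) _; apply: leq_trans (msizeZ_le _ _) _.
by rewrite msizeX; apply: bmdeg.
Qed.

Lemma ridge_poly_supported s : supported_on s (ridge_poly s).
Proof. by move=> j sj; rewrite scoef_unique sj mulr0 mul0r. Qed.

(** Both squares vanish: the weights are the centre of the second one, and by
    [dual_vec_normal_eq] their residual is the centre of the first. *)
Lemma regr_obj_ridge_poly sh :
  regr_obj r gamma X Y (ridge_poly sh.1) = bin_obj gamma X Y sh.
Proof.
rewrite (regr_obj_complete_squares (sh := sh)) ?msize_sum_smonom //; last first.
  exact: ridge_poly_supported.
rewrite big1 ?mulr0 ?addr0 => [|t _].
  by rewrite big1 ?mulr0 ?addr0 // => j _; rewrite scoef_unique subrr expr0n.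
rewrite [Y t 0](dual_vec_normal_eq sh.1).
under [\sum_j scoef _ _ * _]eq_bigr do rewrite scoef_unique -!mulrA.
rewrite -mulr_sumr; under eq_bigr do rewrite -mulrA.
by rewrite addrK subrr expr0n.
Qed.

(** * Matching the feasible sets *)

Lemma sparse_poly_supported k l sh g : bin_feasible k l sh ->
  (msize g <= r.+1)%N -> supported_on sh.1 g -> sparse_poly r k l g.
Proof.
case=> s_le h_le s_h g_deg g_supp.
have supp_s j : j \in ssupp r g -> sh.1 j.
  by rewrite inE; apply: contraNT => /negbTE /g_supp ->.
split=> //.
  apply: leq_trans s_le; rewrite -sum1_card big_mkcond.
  by apply: leq_sum => j _; case: ifP => // /supp_s ->.
apply: leq_trans h_le; rewrite -sum1_card big_mkcond.
apply: leq_sum => i _; case: ifP => // /bigcupP[j /supp_s sj /s_h].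
by rewrite sj.
Qed.

Definition poly_binvars g : binvars p r :=
  ([ffun j => j \in ssupp r g],
   [ffun i => i \in \bigcup_(j in ssupp r g) ancestors j]).

Lemma bin_feasible_of_poly k l g :
  sparse_poly r k l g -> bin_feasible k l (poly_binvars g).
Proof.
have card_ffun (T : finType) (A : {set T}) :
    (\sum_x [ffun x => x \in A] x = #|A|)%N.
  rewrite -sum1_card [RHS]big_mkcond.
  by apply: eq_bigr => x _; rewrite ffunE; case: (x \in A).
case=> _ supp_le anc_le; split; rewrite /= ?card_ffun // => j i j_i.
rewrite !ffunE; case jS: (j \in ssupp r g) => //.
by rewrite (_ : i \in _) //; apply/bigcupP; exists j.
Qed.

Lemma supported_on_poly_binvars g : supported_on (poly_binvars g).1 g.
Proof. by move=> j; rewrite ffunE inE => /negbFE /eqP. Qed.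

(** * Comparing the optimal values *)

Lemma bin_optimal_exists k l :
  exists sh, is_optimal (@bin_feasible p r k l) (bin_obj gamma X Y) sh.
Proof.
pose feasb sh := [&& \sum_j sh.1 j <= l, \sum_i sh.2 i <= k
  & [forall j, forall i in ancestors j, sh.1 j <= sh.2 i]]%N.
have feasP sh : reflect (bin_feasible k l sh) (feasb sh).
  apply: (iffP and3P) => [] [s_le h_le s_h]; split=> //.
    by move=> j i; move/forallP: s_h => /(_ j) /forall_inP; apply.
  by apply/forallP => j; apply/forall_inP => i; apply: s_h.
pose sh0 : binvars p r := ([ffun=> false], [ffun=> false]).
have feas0 : feasb sh0.
  by apply/feasP; split=> [||j i _] /=; rewrite ?big1 // => *; rewrite ffunE.
case: (arg_minP (bin_obj gamma X Y) feas0) => sh /feasP sh_feas sh_min.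
by exists sh; split=> // sh' /feasP; apply: sh_min.
Qed.

Lemma ridge_poly_sparse k l sh :
  bin_feasible k l sh -> sparse_poly r k l (ridge_poly sh.1).
Proof.
move=> sh_feas; apply: (sparse_poly_supported sh_feas).
  exact: msize_sum_smonom.
exact: ridge_poly_supported.
Qed.

(** A sparse [g] costs at least the (Q)-value of its own pair
    [poly_binvars g], hence at least the optimal value of (Q). *)
Lemma ridge_poly_optimal k l sh :
    is_optimal (@bin_feasible p r k l) (bin_obj gamma X Y) sh ->
  is_optimal (@sparse_poly R p r k l) (regr_obj r gamma X Y)
    (ridge_poly sh.1).
Proof.
case=> sh_feas sh_min; split=> [|g g_sparse]; first exact: ridge_poly_sparse.
rewrite regr_obj_ridge_poly.
apply: le_trans (sh_min _ (bin_feasible_of_poly g_sparse)) _.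
by case: g_sparse => g_deg _ _; apply: bin_obj_le => //;
  apply: supported_on_poly_binvars.
Qed.

(** Each [sh'] feasible for (Q) costs as much as its own sparse polynomial
    [ridge_poly sh'.1], hence at least as much as [g]. *)
Lemma bin_optimal_of_poly k l sh g : bin_feasible k l sh ->
    is_optimal (@sparse_poly R p r k l) (regr_obj r gamma X Y) g ->
    supported_on sh.1 g ->
  is_optimal (@bin_feasible p r k l) (bin_obj gamma X Y) sh.
Proof.
move=> sh_feas [[g_deg _ _] g_min] g_supp; split=> // sh' sh'_feas.
apply: le_trans (bin_obj_le g_deg g_supp) _.
by rewrite -(regr_obj_ridge_poly sh'); apply/g_min/ridge_poly_sparse.
Qed.

End Regression.

Theorem theorem1 (R : realType) (n p r k l : nat) (gamma : R)
  (X : 'M[R]_(n, p)) (Y : 'cV[R]_n)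
  (hn : (1 <= n)%N) (hp : (1 <= p)%N) (hr : (1 <= r)%N)
  (hk : (1 <= k)%N) (hl : (1 <= l)%N) (hgamma : 0 < gamma) :
  [/\ forall j : 'X_{1..p < r.+1}, is_psd (kernel_mx X j),
      exists v : R,
        is_optval (@sparse_poly R p r k l) (@regr_obj R n p r gamma X Y) v /\
        is_optval (@bin_feasible p r k l) (@bin_obj R n p r gamma X Y) v
    & forall sh : binvars p r, bin_feasible k l sh ->
        (is_optimal (@bin_feasible p r k l) (@bin_obj R n p r gamma X Y) sh <->
         exists g : {mpoly R[p]},
           is_optimal (@sparse_poly R p r k l)
                      (@regr_obj R n p r gamma X Y) g /\
           forall j : 'X_{1..p < r.+1}, sh.1 j = false -> scoef g j = 0)].
Proof.
split=> [j||sh sh_feas]; first exact: kernel_mx_psd.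
  have [sh sh_opt] := @bin_optimal_exists R n p r gamma X Y k l.
  exists (bin_obj gamma X Y sh); split; last by exists sh.
  exists (ridge_poly gamma X Y sh.1); first exact: ridge_poly_optimal.
  exact: regr_obj_ridge_poly.
split=> [sh_opt | [g [g_opt g_supp]]]; last exact: bin_optimal_of_poly g_supp.
exists (ridge_poly gamma X Y sh.1).
by split; [apply: ridge_poly_optimal | apply: ridge_poly_supported].
Qed.
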